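(* Let $(X_n)_{n\in\mathbb{N}}$ be a Markov chain on a finite state space $S$ with transition probability matrix $P$ and associated graph $G=(S,E)$. Let $C_1,\dots,C_l$ be the maximal communicating classes of $G$, let $\mu_1,\dots,\mu_l$ be the extreme invariant measures, $\mu_\nu$ being the unique invariant distribution with support $C_\nu$, and put $C=\bigcup_{\nu=1}^lC_\nu$, $D=S\setminus C$. Assume that all $C_\nu$, $\nu=1,\dots,l$, are aperiodic and that the initial distribution $\mathcal{D}(X_0)$ is concentrated in $D$. Then $$\lim_{n\to\infty}\mathcal{D}(X_n)=\sum_{\nu=1}^{l}p_\nu\mu_\nu,$$ where $p_\nu=\mathbb{P}\{X_{\tau_C}\in C_\nu\mid X_0\in D\}$ and $\tau_C=\inf\{n\ge1:X_n\in C\}$.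
   Context: Markov chains are time-homogeneous; $p(i,j)$ are the entries of $P$; $\mathcal{D}(X_n)$ is the distribution of $X_n$, viewed as a vector in $\mathbb{R}^{S}$, and the limit is in that space. The associated graph $G=(S,E)$ has $(i,j)\in E$ iff $p(i,j)>0$. Write $i\sim j$ if there are directed paths of length $\ge 1$ in $G$ from $i$ to $j$ and from $j$ to $i$; let $V_c=\{i\in S:i\sim j \text{ for some } j\in S\}$; the communicating classes of $G$ are the sets $[i]=\{j\in S: j\sim i\}$, $i\in V_c$. They are partially ordered by $C_\mu\preceq C_\nu$ iff there is a path in $G$ from some vertex of $C_\mu$ to some vertex of $C_\nu$; ''maximal'' means maximal with respect to $\preceq$. A communicating class is aperiodic if the greatest common divisor of the lengths of the loops (closed paths of length $\ge1$) of the subgraph of $G$ induced on it is $1$. A probability distribution $\pi$ on $S$ is invariant if $\pi^T=\pi^TP$; an invariant distribution is extreme if it is not a nontrivial convex combination of two different invariant distributions. Each maximal communicating class is the support of exactly one invariant distribution, and these are exactly the extreme invariant distributions. *)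

(* Defs.v *)
From mathcomp Require Import all_boot all_order all_algebra.
From mathcomp Require Import all_classical all_reals all_analysis.

Set Implicit Arguments.
Unset Strict Implicit.
Unset Printing Implicit Defensive.

Import Order.TTheory GRing.Theory Num.Theory.
Import numFieldNormedType.Exports.

Local Open Scope classical_set_scope.
Local Open Scope ring_scope.

Section DirectedGraph.
Variables (S : finType) (e : rel S).
Implicit Types (i j : S) (n : nat) (A B K : {set S}).

(* The length [n] of a walk is its number of edges; vertices may repeat. *)
Definition walk i j n : Prop :=
  exists s : seq S, [/\ path e i s, last i s = j & size s = n].

Definition has_path i j : Prop := exists2 n, (0 < n)%N & walk i j n.

Definition communicate i j : Prop := has_path i j /\ has_path j i.

(* [V_c]: a vertex lying on no closed path belongs to no class. *)
Definition communicating_vertex i : Prop := exists j, communicate i j.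

Definition class_of i : {set S} := finset (fun j => `[< communicate j i >]).

Definition communicating_class A : Prop :=
  exists2 i, communicating_vertex i & A = class_of i.

Definition class_le A B : Prop :=
  exists i j, [/\ i \in A, j \in B & has_path i j].

Definition maximal_class A : Prop :=
  communicating_class A /\
  forall B, communicating_class B -> class_le A B -> B = A.

End DirectedGraph.

Definition induced (S : finType) (e : rel S) (K : {set S}) : rel S :=
  fun i j => [&& i \in K, j \in K & e i j].

Definition loop_lengths (S : finType) (e : rel S) : set nat :=
  [set n | (0 < n)%N /\ exists i, walk e i i n].

(* The gcd of a possibly infinite set of natural numbers. *)
Definition is_gcd (A : set nat) (d : nat) : Prop :=
  (forall n, A n -> (d %| n)%N) /\
  (forall d', (forall n, A n -> (d' %| n)%N) -> (d' %| d)%N).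

Definition aperiodic (S : finType) (e : rel S) (K : {set S}) : Prop :=
  is_gcd (loop_lengths (induced e K)) 1.

Section TransitionMatrix.
Variables (R : realType) (S : finType).
Implicit Types (p : S -> S -> R) (pi : S -> R).

Definition distribution_on pi : Prop :=
  (forall i, 0 <= pi i) /\ \sum_i pi i = 1.

Definition stochastic p : Prop := forall i, distribution_on (p i).

Definition edge p : rel S := fun i j => 0 < p i j.

Definition supp pi : {set S} := finset (fun i => pi i != 0).

Definition invariant_distribution p pi : Prop :=
  distribution_on pi /\ forall j, pi j = \sum_i pi i * p i j.

Definition extreme_invariant p pi : Prop :=
  invariant_distribution p pi /\
  ~ exists (pi1 pi2 : S -> R) (t : R),
      [/\ invariant_distribution p pi1, invariant_distribution p pi2,
          pi1 <> pi2, 0 < t < 1 &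
          forall i, pi i = t * pi1 i + (1 - t) * pi2 i].

End TransitionMatrix.

Section MarkovChain.
Context {R : realType} {d : measure_display} {T : measurableType d}.
Variables (P : probability T R) (S : finType).
Implicit Types (A B : set T) (X : nat -> T -> S) (p : S -> S -> R).

(* Meaningful only when [P B] is nonzero. *)
Definition cond_prob A B : R := fine (P (A `&` B)) / fine (P B).

Definition law (Y : T -> S) : S -> R := fun i => fine (P (Y @^-1` [set i])).

(* As [S] is finite, measurability for its discrete sigma-algebra amounts to
   measurability of the fibres. *)
Definition discrete_random_variable (Y : T -> S) : Prop :=
  forall i, measurable (Y @^-1` [set i]).

Definition markov_chain p X : Prop :=
  [/\ stochastic p,
      forall n, discrete_random_variable (X n) &
      forall (n : nat) (x : nat -> S),
        let past := [set w | forall k, (k <= n)%N -> X k w = x k] in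
        P past != 0%E ->
        cond_prob [set w | X n.+1 w = x n.+1] past = p (x n) (x n.+1)].

(* [inf {n >= 1 : X_n \in C}], equal to [+oo] when [C] is never entered. *)
Definition hitting_time X (C : {set S}) (w : T) : \bar R :=
  ereal_inf [set (n%:R : R)%:E | n in [set n | (0 < n)%N /\ X n w \in C]].

(* The event [X_tau \in A], which contains the requirement [tau < +oo]. *)
Definition stopped_in X (tau : T -> \bar R) (A : {set S}) : set T :=
  [set w | exists2 n : nat, tau w = (n%:R : R)%:E & X n w \in A].

End MarkovChain.

(* Main.v *)
Require Import Defs.
From mathcomp Require Import all_boot all_order all_algebra.
From mathcomp Require Import all_classical all_reals all_analysis.
From mathcomp Require Import zify ring lra.
Import Order.TTheory GRing.Theory Num.Theory.
Import numFieldNormedType.Exports.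
Local Open Scope classical_set_scope.
Local Open Scope ring_scope.

Set Implicit Arguments.
Unset Strict Implicit.
Unset Printing Implicit Defensive.

(** The signed vectors v_n = D(X_n) - sum_nu p_nu mu_nu evolve by
    v_(n+1) = v_n P.  On each maximal class C_nu the total mass of v_n tends to
    0, since P(X_n \in C_nu) increases to p_nu; the mass of D(X_n) on D decays
    geometrically, since C can be reached from every state; and by Doeblin's
    argument some power of P contracts the l^1 norm on an aperiodic C_nu, up to
    these two vanishing terms.  Hence v_n tends to 0. *)

(** * Walks and communicating classes of a finite directed graph *)

Section Walks.
Variables (S : finType) (e : rel S).
Implicit Types (i j k : S) (A B K : {set S}).

Lemma walk0 i : walk e i i 0.
Proof. by exists [::]. Qed.

Lemma walk_cat i j k m n : walk e i j m -> walk e j k n -> walk e i k (m + n).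
Proof.
move=> [s [es ls <-]] [t [et lt <-]]; exists (s ++ t).
by rewrite cat_path last_cat size_cat es ls et.
Qed.

Lemma walk1 i j : e i j -> walk e i j 1.
Proof. by move=> eij; exists [:: j]; split=> //=; rewrite eij. Qed.

Lemma walkS i j n : walk e i j n.+1 -> exists2 k, e i k & walk e k j n.
Proof.
by case=> -[|k s] [] //= /andP[eik es] ls [sz]; exists k => //; exists s.
Qed.

Lemma walk_connect i j n : walk e i j n -> connect e i j.
Proof. by move=> [s [es ls _]]; apply/connectP; exists s. Qed.

Lemma connect_walk i j : connect e i j -> exists n, walk e i j n.
Proof. by move=> /connectP[s es ls]; exists (size s), s. Qed.

Lemma has_path_connect i j : has_path e i j -> connect e i j.
Proof. by move=> [n _ /walk_connect]. Qed.

Lemma edge_connect_has_path i j k : e i j -> connect e j k -> has_path e i k.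
Proof.
move=> eij /connect_walk[n wn]; exists n.+1 => //.
by rewrite -add1n; apply: walk_cat wn; apply: walk1.
Qed.

Lemma has_path_connectl i j k :
  connect e i j -> has_path e j k -> has_path e i k.
Proof.
move=> /connect_walk[m wm] [n n0 wn]; exists (m + n)%N; last exact: walk_cat wn.
by rewrite addn_gt0 n0 orbT.
Qed.

Lemma has_path_trans i j k : has_path e i j -> has_path e j k -> has_path e i k.
Proof. by move=> /has_path_connect; apply: has_path_connectl. Qed.

Lemma communicate_sym i j : communicate e i j -> communicate e j i.
Proof. by case. Qed.

Lemma communicate_trans i j k :
  communicate e i j -> communicate e j k -> communicate e i k.
Proof.
move=> [ij ji] [jk kj].
by split; [apply: has_path_trans jk|apply: has_path_trans ji].
Qed.

Lemma mem_class_of i j : j \in class_of e i <-> communicate e j i.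
Proof. by rewrite inE; split=> /asboolP. Qed.

Lemma class_of_eq i j : communicate e i j -> class_of e i = class_of e j.
Proof.
move=> ij; apply/setP => k; apply/idP/idP => /mem_class_of ki.
  by apply/mem_class_of; apply: communicate_trans ij.
by apply/mem_class_of; apply: communicate_trans (communicate_sym ij).
Qed.

Lemma communicating_classP A i :
  communicating_class e A -> i \in A -> communicate e i i /\ A = class_of e i.
Proof.
move=> [a _ ->] /mem_class_of ia; split; last exact/class_of_eq/communicate_sym.
by apply: communicate_trans (communicate_sym ia).
Qed.

Lemma communicating_class_eq A B i : communicating_class e A ->
  communicating_class e B -> i \in A -> i \in B -> A = B.
Proof.
by move=> cA cB /(communicating_classP cA)[_ ->] /(communicating_classP cB)[_ ->].
Qed.

Lemma communicating_class_connect A i j :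
  communicating_class e A -> i \in A -> j \in A -> connect e i j.
Proof.
move=> cA /(communicating_classP cA)[_ ->] /mem_class_of[_ ij].
exact: has_path_connect.
Qed.

Lemma communicating_class_neq0 A :
  communicating_class e A -> exists i, i \in A.
Proof.
move=> [i [j ij] ->]; exists i; apply/mem_class_of.
exact: communicate_trans (communicate_sym ij).
Qed.

Hypothesis succ : forall i, exists j, e i j.

(* A state reached from [i] from which as few states as possible can be
   reached lies in a maximal class. *)
Lemma connect_maximal_class i :
  exists A j, [/\ maximal_class e A, j \in A & connect e i j].
Proof.
have [j ij jmin] :=
  arg_minnP (fun j => #|[set k | connect e j k]%SET|) (connect0 e i).
(* A state [k] reachable from [j] reaches no more states than [j], and by minimality no fewer; so it
   reaches the same ones, [j] included. *)
have back k : connect e j k -> connect e k j.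
  move=> jk; have /jmin : connect e i k by apply: connect_trans jk.
  have sub : [set l | connect e k l]%SET \subset [set l | connect e j l]%SET.
    by apply/fintype.subsetP => l; rewrite !inE; apply: connect_trans.
  rewrite (geq_leqif (subset_leqif_card sub)) => /fintype.subsetP/(_ j).
  by rewrite !inE connect0 => /(_ isT).
have [k jk] := succ j.
have jj : has_path e j j.
  by apply: (edge_connect_has_path jk); apply: back; apply: connect1.
exists (class_of e j), j; split=> //; last exact/mem_class_of.
split; first by exists j => //; exists j.
move=> B cB [a [b [/mem_class_of[aj ja] bB ab]]].
have jb := has_path_trans ja ab.
have bj := has_path_connectl (back _ (has_path_connect jb)) jj.
have [_ ->] := communicating_classP cB bB.
exact: class_of_eq.
Qed.

(** From [j] some maximal class [B] can be reached, and [B] lies above [A]. Maximality of [A] gives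
    [B = A], so a path leads from [j] back into [A]. *)
Lemma maximal_class_closed A i j :
  maximal_class e A -> i \in A -> e i j -> j \in A.
Proof.
move=> [cA maxA] iA eij.
have [B [b [[cB _] bB jb]]] := connect_maximal_class j.
have BA : B = A.
  by apply: maxA => //; exists i, b; split=> //; apply: edge_connect_has_path jb.
rewrite BA in bB.
have [ii Ai] := communicating_classP cA iA.
have bi : connect e b i by exact: communicating_class_connect bB iA.
rewrite Ai; apply/mem_class_of; split; last by apply: edge_connect_has_path eij _.
by apply: (has_path_connectl jb); apply: (has_path_connectl bi); case: ii.
Qed.

(* Once the closed set [A] is reached one can keep walking in it, so walks of
   different lengths can be extended to a common length. *)
Lemma uniform_walk_to A : (forall i j, i \in A -> e i j -> j \in A) ->
  (forall i, exists2 j, j \in A & connect e i j) ->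
  exists N, forall i, exists2 j, j \in A & walk e i j N.
Proof.
move=> clA reach.
have /choice[a aP] : forall i, exists n, exists2 j, j \in A & walk e i j n.
  by move=> i; have [j jA /connect_walk[n wn]] := reach i; exists n, j.
exists (\max_i a i)%N => i.
have [j jA wj] := aP i.
have ext m : exists2 k, k \in A & walk e j k m.
  elim: m => [|m [k kA wk]]; first by exists j => //; apply: walk0.
  have [k' kk'] := succ k; exists k'; first exact: clA kk'.
  by rewrite -addn1; apply: walk_cat wk _; apply: walk1.
have [k kA wk] := ext (\max_i a i - a i)%N.
exists k => //; rewrite -(subnKC (leq_bigmax i)); exact: walk_cat wk.
Qed.

End Walks.

(** * Aperiodicity and walks of a common length *)

(* Closure under addition and gcd 1: the least positive difference of two
   elements of [A] divides every element, so [A] contains some [y] and [y + 1];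
   hence every [n >= y ^ 2]. *)
Lemma numerical_semigroup_cofinite (A : set nat) :
  A 0%N -> (forall m n, A m -> A n -> A (m + n)%N) ->
  (forall d, (forall n, A n -> (d %| n)%N) -> (d %| 1)%N) ->
  exists n0, forall n, (n0 <= n)%N -> A n.
Proof.
move=> A0 AD Agcd.
have AM q m : A m -> A (q * m)%N.
  by move=> Am; elim: q => [//|q IH]; rewrite mulSn; apply: AD.
pose D n := `[< (0 < n)%N /\ exists2 y, A y & A (y + n)%N >].
have exD : exists n, D n.
  case: (pselect (exists2 n, (0 < n)%N & A n)) => [[n n0 An]|nA].
    by exists n; apply/asboolP; split=> //; exists 0%N.
  (* Here [A] is reduced to 0, so 0 divides every element and the gcd hypothesis would give the
     absurd 0 | 1. *)
  have : (0 %| 1)%N.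
    apply: Agcd => n An; rewrite dvd0n; apply/negPn/negP => n0; apply: nA.
    by exists n => //; rewrite lt0n.
  by [].
have [d /asboolP[d0 [y Ay Ayd]] dmin] := ex_minnP exD.
have {}dmin r : (0 < r)%N -> (r < d)%N -> ~ (exists2 z, A z & A (z + r)%N).
  by move=> r0 rd ex; have := dmin r (asboolT (conj r0 ex)); rewrite leqNgt rd.
have d1 : (d %| 1)%N.
  apply: Agcd => a Aa; rewrite /dvdn; apply/negPn/negP; rewrite -lt0n => r0.
  (* With [q = a %/ d], both [q * (y + d)] and [a + q * y] lie in [A], and they differ by the
     remainder [a %% d], which is smaller than [d]. *)
  apply: (dmin _ r0 (ltn_pmod a d0)); exists (a %/ d * (y + d))%N; first exact: AM.
  have -> : (a %/ d * (y + d) + a %% d = a + a %/ d * y)%N.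
    by rewrite mulnDr -addnA -divn_eq addnC.
  by apply: AD => //; apply: AM.
move: d1; rewrite dvdn1 => /eqP d1; rewrite d1 addn1 in Ayd.
exists (y * y)%N => n ny.
case: (posnP y) => [y0|y0].
  by rewrite -(muln1 n); apply: AM; rewrite y0 in Ayd.
(* For [n = q * y + r] with [r <= q], trading [r] copies of [y] for [y + 1] gives
   [n = (q - r) * y + r * (y + 1)]. *)
have rq : (n %% y <= n %/ y)%N.
  have := ltn_pmod n y0; have : (y <= n %/ y)%N by rewrite leq_divRL.
  by lia.
have -> : n = ((n %/ y - n %% y) * y + (n %% y) * y.+1)%N.
  by rewrite {1}(divn_eq n y) mulnS addnCA -mulnDl subnK // addnC.
by apply: AD; apply: AM.
Qed.

(** The lengths of closed walks at a fixed vertex [a] form an additive semigroup of gcd 1, hence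
    contain all large numbers. Walks from [i] to [j] are routed through [a], and a closed walk at
    [a] pads them to a common length. *)
Lemma aperiodic_uniform_walk (S : finType) (e : rel S) (A : {set S}) :
  communicating_class e A -> aperiodic e A ->
  exists N, forall i j, i \in A -> j \in A -> walk e i j N.
Proof.
move=> cA [_ apA].
have [a aA] := communicating_class_neq0 cA.
(* The memberships stand under the existential so that [choice] can later pick a length for every
   pair of states. *)
have conn i j : exists n, i \in A -> j \in A -> walk e i j n.
  case: (boolP ((i \in A) && (j \in A))) => [/andP[iA jA]|nA].
    have [n wn] := connect_walk (communicating_class_connect cA iA jA).
    by exists n.
  by exists 0%N => iA jA; rewrite iA jA in nA.
have [n0 n0P] : exists n0, forall n, (n0 <= n)%N -> [set n | walk e a a n] n.
  apply: numerical_semigroup_cofinite => [|m n|d dP]; first exact: walk0.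
    exact: walk_cat.
  apply: apA => n [npos [i wi]].
  have iA : i \in A by case: n npos wi => // n _ /walkS[k /and3P[]].
  have {}wi : walk e i i n.
    case: wi => s [ps ls sz]; exists s; split=> //.
    by apply: sub_path ps => x y /and3P[].
  (* A detour from [a] to [i] and back is closed with or without the loop at [i] inserted; [d]
     divides both lengths, hence their difference [n]. *)
  have [m1 /(_ aA iA) w1] := conn a i; have [m2 /(_ iA aA) w2] := conn i a.
  rewrite -(dvdn_addr n (dP _ (walk_cat w1 w2))) addnAC.
  exact: dP (walk_cat (walk_cat w1 wi) w2).
have /choice[f fP] : forall ij, exists n,
    ij.1 \in A -> ij.2 \in A -> walk e ij.1 ij.2 n.
  by move=> [i j]; apply: conn.
pose M := (\max_ij f ij)%N.
(* The two outer legs have length at most [M] each, which leaves at least [n0] for the closed walk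
   at [a]. *)
exists (M + n0 + M)%N => i j iA jA.
have l1 : (f (i, a) <= M)%N by apply: leq_bigmax.
have l2 : (f (a, j) <= M)%N by apply: leq_bigmax.
have -> : (M + n0 + M =
    f (i, a) + (M + n0 + M - f (i, a) - f (a, j)) + f (a, j))%N by lia.
apply: walk_cat (fP (a, j) aA jA).
by apply: walk_cat (fP (i, a) iA aA) _; apply: n0P; lia.
Qed.

(** * Powers of the transition matrix and contraction *)

(** The entries of the [n]-th power of the transition matrix, split off at the first step as walks
    are in [walkS]. *)
Fixpoint nstep (R : pzSemiRingType) (S : finType) (p : S -> S -> R) n i j : R :=
  if n is m.+1 then \sum_k p i k * nstep p m k j else (i == j)%:R.

(** Starting the minimum at 1 covers an empty index set and yields the bound [delta <= 1] that the
    contraction needs. *)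
Lemma finite_lower_bound (R : realType) (I : finType) (Q : {pred I}) (f : I -> R) :
  (forall i, Q i -> 0 < f i) ->
  exists delta, [/\ 0 < delta, delta <= 1 & forall i, Q i -> delta <= f i].
Proof.
move=> f0; exists (\big[Num.min/1]_(i | Q i) f i); split.
- by apply: lt_bigmin.
- exact: bigmin_le_id.
- by move=> i; apply: bigmin_le_cond.
Qed.

(* As soon as [eps <= delta * e], the recursion contracts [y - e] by the factor
   [1 - delta]. *)
Lemma contraction_cvg0 (R : realType) (y eps : nat -> R) N delta :
  (forall n, 0 <= y n) -> 0 < delta -> delta <= 1 ->
  (forall n, y (n + N)%N <= (1 - delta) * y n + eps n) ->
  eps n @[n --> \oo] --> 0 -> y n @[n --> \oo] --> 0.
Proof.
move=> y0 d0 d1 yN eps0; apply/cvgrPdist_le => e e0.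
have e2 : 0 < e / 2 by rewrite divr_gt0.
have [n0 _ n0P] : \forall n \near \oo, eps n <= delta * (e / 2).
  have /cvgrPdist_le/(_ _ (mulr_gt0 d0 e2)) := eps0; apply: filterS => n.
  by rewrite sub0r normrN; apply: le_trans; apply: ler_norm.
(* For [N = 0] there is nothing to iterate: the recursion itself amounts to
   [delta * y n <= eps n]. *)
case: (posnP N) => [N0|N0].
  exists n0 => // n /= /n0P epsn; rewrite sub0r normrN ger0_norm //.
  have := yN n; rewrite N0 addn0 => yn.
  suff : delta * y n <= delta * (e / 2) by rewrite ler_pM2l //; lra.
  by apply: le_trans epsn; lra.
have step k n : (n0 <= n)%N ->
    y (n + k * N)%N - e / 2 <= (1 - delta) ^+ k * (y n - e / 2).
  move=> nn0; elim: k => [|k IH]; first by rewrite addn0 expr0 mul1r.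
  rewrite mulSn addnCA addnC.
  have epsk : eps (n + k * N)%N <= delta * (e / 2).
    by apply: n0P => /=; rewrite (leq_trans nn0) ?leq_addr.
  apply: (@le_trans _ _ ((1 - delta) * (y (n + k * N)%N - e / 2))).
    by have := yN (n + k * N)%N; lra.
  by rewrite exprS -mulrA ler_wpM2l // subr_ge0.
(* Each residue class modulo [N] decays from its own starting value [y (n0 + r)]; [B] bounds all of
   them, so that one [k0] serves every class. *)
pose B := \sum_(r < N) y (n0 + r)%N.
have : (1 - delta) ^+ k * B @[k --> \oo] --> 0 * B.
  apply: cvgMl; apply: cvg_expr; rewrite ger0_norm ?subr_ge0 //; lra.
rewrite mul0r => /cvgrPdist_le/(_ _ e2)[k0 _ k0P].
exists (n0 + k0 * N)%N => // n /= nk; rewrite sub0r normrN ger0_norm //.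
pose r := ((n - n0) %% N)%N; pose k := ((n - n0) %/ N)%N.
have nE : n = (n0 + r + k * N)%N.
  by rewrite -addnA [(r + _)%N]addnC -divn_eq; lia.
have kk0 : (k0 <= k)%N by rewrite leq_divRL //; lia.
have := k0P _ kk0; rewrite sub0r normrN => kB.
have := step k (n0 + r)%N (leq_addr _ _); rewrite -nE => h.
have yB : y (n0 + r)%N <= B.
  have rN : (r < N)%N by apply: ltn_pmod.
  by rewrite /B (bigD1 (Ordinal rN)) //= lerDl sumr_ge0.
have : (1 - delta) ^+ k * (y (n0 + r)%N - e / 2) <= (1 - delta) ^+ k * B.
  by apply: ler_wpM2l; [rewrite exprn_ge0 // subr_ge0|lra].
have := ler_norm ((1 - delta) ^+ k * B); lra.
Qed.

Section NStep.
Variables (R : realType) (S : finType) (p : S -> S -> R).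
Hypothesis p_stoch : stochastic p.
Implicit Types (i j k : S) (A B : {set S}).

Lemma stochastic_ge0 i j : 0 <= p i j.
Proof. by case: (p_stoch i). Qed.

Lemma stochastic_succ i : exists j, edge p i j.
Proof.
apply: contrapT => /forallNP nex; have [_ /eqP] := p_stoch i.
rewrite big1 ?(eq_sym 0) ?oner_eq0 // => j _; apply/eqP.
by rewrite eq_le stochastic_ge0 andbT leNgt; apply/negP/nex.
Qed.

Lemma nstep_ge0 n i j : 0 <= nstep p n i j.
Proof.
elim: n i => [|n IH] i /=; first by rewrite ler0n.
by apply: sumr_ge0 => k _; rewrite mulr_ge0 ?stochastic_ge0.
Qed.

Lemma nstep_sum1 n i : \sum_j nstep p n i j = 1.
Proof.
elim: n i => [|n IH] i /=.
  by rewrite (bigD1 i) //= eqxx big1 ?addr0 // => j; rewrite eq_sym => /negPf ->.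
rewrite exchange_big /=; under eq_bigr do rewrite -mulr_sumr IH mulr1.
by case: (p_stoch i).
Qed.

Lemma nstep_gt0 n i j : walk (edge p) i j n -> 0 < nstep p n i j.
Proof.
elim: n i => [|n IH] i; first by case=> -[|? ?] [] //= _ <- _; rewrite eqxx ltr01.
move=> /walkS[k pik /IH knj] /=; rewrite (bigD1 k) //= ltr_pwDl ?mulr_gt0 //.
by apply: sumr_ge0 => l _; rewrite mulr_ge0 ?stochastic_ge0 ?nstep_ge0.
Qed.

Lemma nstep_closed A n i j : (forall i j, i \in A -> edge p i j -> j \in A) ->
  i \in A -> j \notin A -> nstep p n i j = 0.
Proof.
move=> clA; elim: n i => [|n IH] i iA jA /=.
  by case: eqP => // ij; rewrite -ij iA in jA.
apply: big1 => k _; case: (boolP (edge p i k)) => [/(clA _ _ iA) kA|].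
  by rewrite IH ?mulr0.
rewrite /edge -leNgt => pik; suff -> : p i k = 0 by rewrite mul0r.
by apply/eqP; rewrite eq_le pik stochastic_ge0.
Qed.

Lemma evolution_nstep (v : nat -> S -> R) m n j :
  (forall n j, v n.+1 j = \sum_i v n i * p i j) ->
  v (m + n)%N j = \sum_i v m i * nstep p n i j.
Proof.
move=> vS; elim: n m => [|n IH] m.
  rewrite addn0 (bigD1 j) //= eqxx mulr1 big1 ?addr0 // => i /negPf ->.
  by rewrite mulr0.
rewrite addnS -addSn IH /=.
under eq_bigr do rewrite vS mulr_suml.
rewrite exchange_big; apply: eq_bigr => k _; rewrite mulr_sumr.
by apply: eq_bigr => i _; rewrite mulrA.
Qed.

(** From every state a fraction at least [delta] enters the closed set [A] in [N] steps and nothing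
    leaves it, so [N] steps multiply the mass outside [A] by at most [1 - delta]. *)
Lemma transient_mass_cvg0 A N (v : nat -> S -> R) :
  (forall i j, i \in A -> edge p i j -> j \in A) ->
  (forall i, exists2 j, j \in A & walk (edge p) i j N) ->
  (forall n j, v n.+1 j = \sum_i v n i * p i j) -> (forall n i, 0 <= v n i) ->
  \sum_(i | i \notin A) v n i @[n --> \oo] --> 0.
Proof.
move=> clA reach vS v0.
have [|delta [d0 d1 dP]] := @finite_lower_bound R S predT
    (fun i => \sum_(j in A) nstep p N i j).
  move=> i _; have [j jA /nstep_gt0 ij] := reach i.
  rewrite (bigD1 j) //= ltr_pwDl // sumr_ge0 // => k _; exact: nstep_ge0.
apply: (@contraction_cvg0 R _ (fun=> 0) N delta) => //; last exact: cvg_cst.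
- by move=> n; apply: sumr_ge0.
move=> n; rewrite addr0 mulr_sumr.
under eq_bigr do rewrite (evolution_nstep _ _ _ vS).
rewrite exchange_big /= (bigID (mem A)) /= big1 ?add0r; last first.
  by move=> i iA; apply: big1 => j jA; rewrite (nstep_closed N clA iA jA) mulr0.
apply: ler_sum => i iA; rewrite -mulr_sumr mulrC ler_wpM2r //.
have := nstep_sum1 N i; rewrite (bigID (mem A)) /= => <-.
by rewrite lerBrDl lerD2r dP.
Qed.

(* Doeblin's argument: all [N]-step probabilities inside [A] are at least
   [delta], and subtracting [delta] from them changes nothing but a multiple of
   the total mass on [A]; the remaining kernel contracts the l^1 norm. *)
Lemma zero_mass_cvg0 A B N (v : nat -> S -> R) :
  (exists i, i \in A) ->
  (forall i j, i \in A -> edge p i j -> j \in A) ->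
  (forall i j, i \in B -> edge p i j -> j \in B) ->
  (forall i, i \in A -> i \notin B) ->
  (forall i j, i \in A -> j \in A -> walk (edge p) i j N) ->
  (forall n j, v n.+1 j = \sum_i v n i * p i j) ->
  \sum_(i in A) v n i @[n --> \oo] --> 0 ->
  \sum_(i | (i \notin A) && (i \notin B)) `|v n i| @[n --> \oo] --> 0 ->
  \sum_(i in A) `|v n i| @[n --> \oo] --> 0.
Proof.
move=> [a aA] clA clB AB wA vS mass0 out0.
have [|delta [d0 d1 dP]] := @finite_lower_bound R (S * S)%type
    (fun ij => (ij.1 \in A) && (ij.2 \in A)) (fun ij => nstep p N ij.1 ij.2).
  by move=> [i j] /andP[iA jA]; apply: nstep_gt0; apply: wA.
have {}dP i j : i \in A -> j \in A -> delta <= nstep p N i j.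
  by move=> iA jA; apply: (dP (i, j)); rewrite /= iA jA.
have sumA i : i \in A -> \sum_(j in A) nstep p N i j = 1.
  move=> iA; rewrite -(nstep_sum1 N i) [RHS](bigID (mem A)) /=.
  rewrite [X in _ + X]big1 ?addr0 //.
  by move=> j jA; apply: nstep_closed iA jA.
pose kd := #|A|%:R * delta.
have kdE : \sum_(j in A) delta = kd by rewrite sumr_const /kd mulr_natl.
(* Subtracting [delta] removes [kd] from each row sum over [A], hence the factor [1 - kd]. The error
   consists of the multiple of the total mass that is added back and of the inflow from outside [A]
   and [B]. *)
apply: (@contraction_cvg0 R _ (fun n => kd * `|\sum_(i in A) v n i| +
    \sum_(i | (i \notin A) && (i \notin B)) `|v n i|) N kd).
- by move=> n; apply: sumr_ge0.
- by rewrite mulr_gt0 // ltr0n; apply/card_gt0P; exists a.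
- by rewrite -kdE -(sumA _ aA); apply: ler_sum => j; apply: dP.
- move=> n.
  set s := \sum_(i in A) v n i.
  have inA j : j \in A -> `|v (n + N)%N j| <=
      (\sum_(i in A) `|v n i| * (nstep p N i j - delta) + delta * `|s|) +
      \sum_(i | (i \notin A) && (i \notin B)) `|v n i| * nstep p N i j.
    move=> jA; rewrite (evolution_nstep _ _ _ vS) (bigID (mem A)) /=.
    apply: le_trans (ler_normD _ _) _; apply: lerD.
      have -> : \sum_(i in A) v n i * nstep p N i j =
          \sum_(i in A) v n i * (nstep p N i j - delta) + delta * s.
        by rewrite mulr_sumr -big_split; apply: eq_bigr => i _ /=; ring.
      apply: le_trans (ler_normD _ _) _; rewrite normrM (gtr0_norm d0) lerD2r.
      apply: le_trans (ler_norm_sum _ _ _) _; apply: ler_sum => i iA.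
      by rewrite normrM [X in _ * X]ger0_norm // subr_ge0 dP.
    (* The set [B] is closed and disjoint from [A], so it sends nothing into [A]. *)
    rewrite (bigID (mem B)) /= big1 ?add0r; last first.
      move=> i /andP[iA iB]; rewrite (nstep_closed N clB iB) ?mulr0 //.
      exact: AB.
    apply: le_trans (ler_norm_sum _ _ _) _; apply: ler_sum => i _.
    by rewrite normrM [X in _ * X]ger0_norm ?nstep_ge0.
  apply: le_trans (ler_sum _ inA) _; rewrite !big_split /= addrA; apply: lerD.
    apply: lerD; last by rewrite -mulr_suml kdE.
    rewrite exchange_big /= mulr_sumr; apply: ler_sum => i iA.
    by rewrite -mulr_sumr sumrB sumA // kdE mulrC.
  rewrite exchange_big /=; apply: ler_sum => i _; rewrite -mulr_sumr.
  rewrite -[leRHS]mulr1 ler_wpM2l // -(nstep_sum1 N i) [leRHS](bigID (mem A)) /=.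
  by rewrite lerDl sumr_ge0 // => j _; apply: nstep_ge0.
- rewrite -[X in _ --> X]addr0; apply: cvgD => //.
  rewrite -[X in _ --> X](mulr0 kd); apply: cvgMr.
  by move/cvg_norm: mass0; rewrite normr0.
Qed.

End NStep.

(** * Laws, paths and hitting times of the chain *)

Section FiniteStateProcess.
Variables (R : realType) (d : measure_display) (T : measurableType d).
Variables (P : probability T R) (S : finType).
Implicit Types (A B : set T) (Y : T -> S) (X : nat -> T -> S) (K C : {set S}).

Lemma measurable_discrete_preimage Y (B : set S) :
  Defs.discrete_random_variable Y -> measurable (Y @^-1` B).
Proof.
move=> mY; have -> : Y @^-1` B = \bigcup_(i in B) Y @^-1` [set i].
  apply/seteqP; split=> [w Bw|w [i Bi /= Yw]]; last by rewrite /= Yw.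
  by exists (Y w).
by apply: fin_bigcup_measurable => // i _; apply: mY.
Qed.

Lemma measurable_discrete_in Y K :
  Defs.discrete_random_variable Y -> measurable [set w | Y w \in K].
Proof. exact: (measurable_discrete_preimage [set i | i \in K]). Qed.

Lemma probability_sum_fibres A Y : measurable A -> Defs.discrete_random_variable Y ->
  fine (P A) = \sum_i fine (P (A `&` Y @^-1` [set i])).
Proof.
move=> mA mY; have mAY i : measurable (A `&` Y @^-1` [set i]) by exact: measurableI.
apply: EFin_inj; rewrite EFin_sum_fine => [|i _]; last exact: fin_num_measure.
rewrite fineK ?fin_num_measure //.
have {1}-> : A = \bigcup_(i in [set` index_enum S]) (A `&` Y @^-1` [set i]).
  apply/seteqP; split=> [w Aw|w [i _ []]] //.
  by exists (Y w) => //=; rewrite mem_index_enum.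
rewrite measure_fin_bigcup //.
  by rewrite -fsbig_seq // index_enum_uniq.
by move=> i j _ _ [w [[_ <-] [_ <-]]].
Qed.

Lemma probability_in_sum_law Y K : Defs.discrete_random_variable Y ->
  fine (P [set w | Y w \in K]) = \sum_(i in K) law P Y i.
Proof.
move=> mY; rewrite (probability_sum_fibres (measurable_discrete_in K mY) mY).
rewrite (bigID (mem K)) /= addrC big1 ?add0r => [|i iK].
  apply: eq_bigr => i iK; rewrite /law; congr (fine (P _)).
  by apply/seteqP; split=> [w []|w /= Yw] //; split=> //=; rewrite Yw.
rewrite (_ : _ `&` _ = set0) ?measure0 //.
by apply/seteqP; split=> // w [/= YK Yw]; rewrite -Yw YK in iK.
Qed.

Lemma null_measurable_subset A B : measurable A -> measurable B -> A `<=` B ->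
  P B = 0%E -> P A = 0%E.
Proof.
move=> mA mB AB PB; apply/eqP; rewrite eq_le measure_ge0 andbT -PB.
by apply: le_measure; rewrite ?inE.
Qed.

Lemma fine_probability_eq0 A : measurable A -> fine (P A) = 0 -> P A = 0%E.
Proof. by move=> mA A0; rewrite -(fineK (fin_num_measure P _ mA)) A0. Qed.

Lemma probability_inter_full A B : measurable A -> measurable B ->
  P (~` B) = 0%E -> P (A `&` B) = P A.
Proof.
move=> mA mB PB.
have -> : P A = (P (A `\` B) + P (A `&` B))%E by exact: measureDI.
rewrite (_ : P (A `\` B) = 0%E) ?add0e //.
apply: null_measurable_subset PB; [exact: measurableD|exact: measurableC|].
by move=> w [].
Qed.

(* The histories are shortened one state at a time, summing over the forgotten
   state; [m = 0] is the Markov property and [m = n] is the claim. *)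
Lemma markov_chain_joint (p : S -> S -> R) X n i j : markov_chain P p X ->
  fine (P (X n.+1 @^-1` [set j] `&` X n @^-1` [set i])) = law P (X n) i * p i j.
Proof.
move=> [_ mX markov].
pose past m (x : nat -> S) := [set w | forall k, (m <= k <= n)%N -> X k w = x k].
have mpast m x : measurable (past m x).
  apply: (@bigcap_measurableType _ _ (fun k => X k @^-1` [set x k])
    [set k | (m <= k <= n)%N]).
  by move=> k _; apply: mX.
have H m (x : nat -> S) : (m <= n)%N ->
    fine (P (X n.+1 @^-1` [set x n.+1] `&` past m x)) =
    fine (P (past m x)) * p (x n) (x n.+1).
  elim: m x => [|m IH] x mn.
    have := markov n x.
    rewrite (_ : [set w | forall k, (k <= n)%N -> X k w = x k] = past 0%N x) //.
    (* On a null history the Markov property says nothing, but both sides of the product formula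
       vanish. *)
    have [P0 _|P0 /(_ P0) <-] := eqVneq (P (past 0%N x)) 0%E.
      rewrite P0 mul0r (null_measurable_subset _ _ _ P0) //.
      by apply: measurableI => //; apply: mX.
    have f0 : fine (P (past 0%N x)) != 0.
      by apply: contra_neq P0; apply: fine_probability_eq0.
    by rewrite /cond_prob mulrC divfK.
  (* [y s] puts the state [s] at the forgotten time [m]; as [m < n], the values at times [n] and
     [n.+1] remain those of [x]. *)
  pose y s k := if k == m then s else x k.
  have split s : past m.+1 x `&` X m @^-1` [set s] = past m (y s).
    apply/seteqP; split=> [w [pw mw] k /andP[mk kn]|w pw].
      rewrite /y; case: eqP => [->|/eqP km] //; apply: pw.
      by rewrite kn ltn_neqAle eq_sym km mk.
    split=> [k /andP[mk kn]|/=].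
      by rewrite pw ?(ltnW mk) // /y; case: eqP mk => // ->; rewrite ltnn.
    by rewrite pw ?leqnn ?(ltnW mn) // /y eqxx.
  rewrite (probability_sum_fibres (mpast _ _) (mX m)).
  rewrite (@probability_sum_fibres _ (X m)) //; last first.
    by apply: measurableI => //; apply: mX.
  rewrite mulr_suml; apply: eq_bigr => s _; rewrite -setIA split.
  have := IH (y s) (ltnW mn); rewrite /y.
  by rewrite !gtn_eqF // ltnW.
pose x k := if (k <= n)%N then i else j.
have := H n x (leqnn n); rewrite /x leqnn ltnn.
have -> // : past n x = X n @^-1` [set i].
apply/seteqP; split=> [w /(_ n)|w Xw k]; rewrite /x ?leqnn /=; first exact.
by rewrite -eqn_leq => /eqP <-; rewrite leqnn.
Qed.

Lemma law_markov_step (p : S -> S -> R) X n j : markov_chain P p X ->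
  law P (X n.+1) j = \sum_i law P (X n) i * p i j.
Proof.
move=> mc; have [_ mX _] := mc; rewrite /law (probability_sum_fibres (mX n.+1 j) (mX n)).
by apply: eq_bigr => i _; rewrite (markov_chain_joint _ _ _ mc).
Qed.

(** The complement of [F] is cut into finitely many cells by the values [i] of [X n] and [j] of
    [X n.+1]. A cell is empty if [i], [j] form an edge; otherwise it is null, because the joint
    probability has the factor [p i j = 0]. *)
Lemma markov_chain_follows_edges (p : S -> S -> R) X n : markov_chain P p X ->
  let F := [set w | edge p (X n w) (X n.+1 w)] in
  measurable F /\ P (~` F) = 0%E.
Proof.
move=> mc F; have [p_stoch mX _] := mc.
have FE : F = \bigcup_(i in [set: S])
    (X n @^-1` [set i] `&` X n.+1 @^-1` [set j | edge p i j]).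
  by apply/seteqP; split=> [w Fw|w [i _ [/= <-]]] //; exists (X n w).
have mF : measurable F.
  rewrite FE; apply: fin_bigcup_measurable => // i _.
  by apply: measurableI; [apply: mX|apply: measurable_discrete_preimage].
split=> //; apply: fine_probability_eq0; first exact: measurableC.
have mFC := measurableC mF.
rewrite (probability_sum_fibres mFC (mX n.+1)) big1 // => j _.
have mFj : measurable (~` F `&` X n.+1 @^-1` [set j]).
  by apply: measurableI => //; apply: mX.
rewrite (probability_sum_fibres mFj (mX n)) big1 // => i _.
have mFij : measurable (~` F `&` X n.+1 @^-1` [set j] `&` X n @^-1` [set i]).
  by apply: measurableI => //; apply: mX.
have [pij|pij] := boolP (edge p i j).
  rewrite (_ : _ `&` _ = set0) ?measure0 //.
  by apply/seteqP; split=> // w [[/= nF Xj] Xi]; apply: nF; rewrite /F /= Xi Xj.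
have mij : measurable (X n.+1 @^-1` [set j] `&` X n @^-1` [set i]).
  by apply: measurableI; apply: mX.
rewrite (null_measurable_subset mFij mij) //; first by move=> w [[]].
apply: fine_probability_eq0 => //; rewrite (markov_chain_joint _ _ _ mc).
suff -> : p i j = 0 by rewrite mulr0.
by apply/eqP; rewrite eq_le (stochastic_ge0 p_stoch) andbT leNgt.
Qed.

(** Replaces the infimum in the extended reals by a first entrance. As [K] lies in [C], being in [K]
    at time [n] is a visit to [C], so with no earlier positive visit the infimum is [n]. *)
Lemma stopped_in_hittingP X K C w : K \subset C ->
  stopped_in X (hitting_time X C : T -> \bar R) K w <->
  exists n, [/\ (0 < n)%N, X n w \in K &
    forall k, (0 < k < n)%N -> X k w \notin C].
Proof.
move=> KC; rewrite /stopped_in /hitting_time /=.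
set E := image _ _.
have hit m : (0 < m)%N -> X m w \in C -> (forall k, (0 < k < m)%N -> X k w \notin C) ->
    ereal_inf E = (m%:R)%:E.
  move=> m0 mC before; apply/eqP; rewrite eq_le; apply/andP; split.
    by apply: ereal_inf_lbound; exists m.
  apply: le_ereal_inf_tmp => _ [k [k0 kC] <-]; rewrite lee_fin ler_nat leqNgt.
  by apply/negP => km; have := before k; rewrite k0 km kC => /(_ isT).
split=> [[n infE nK]|[n [n0 nK before]]]; last first.
  by exists n => //; apply: hit => //; apply: (fintype.subsetP KC).
(* Without a visit to [C] at a positive time the infimum runs over the empty set and is [+oo], not a
   natural number. *)
have [ex|nex] := pselect (exists n, (0 < n)%N && (X n w \in C)); last first.
  move: infE; rewrite (_ : E = set0) ?ereal_inf0 //.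
  by apply/seteqP; split=> // x [k [k1 kC] _]; apply: nex; exists k; rewrite k1.
have [m /andP[m0 mC] mmin] := ex_minnP ex.
have before k : (0 < k < m)%N -> X k w \notin C.
  move=> /andP[k1 km]; apply/negP => kC; have := mmin k.
  by rewrite k1 kC leqNgt km => /(_ isT).
move: infE; rewrite (hit m) // => -[/eqP]; rewrite eqr_nat => /eqP mn.
by exists n; rewrite -mn; split=> //; rewrite mn.
Qed.

Lemma measurable_stopped_in_hitting X K C :
  (forall n, Defs.discrete_random_variable (X n)) -> K \subset C ->
  measurable (stopped_in X (hitting_time X C : T -> \bar R) K).
Proof.
move=> mX KC.
have -> : stopped_in X (hitting_time X C : T -> \bar R) K =
    \bigcup_(n in [set n | (0 < n)%N]) ([set w | X n w \in K] `&`
      \bigcap_(k in [set k | (0 < k < n)%N]) ~` [set w | X k w \in C]).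
  apply/seteqP; split=> w; rewrite stopped_in_hittingP //.
    move=> [n [n0 nK before]]; exists n => //; split=> // k kn.
    exact/negP/before.
  move=> [n n0 [nK before]]; exists n; split=> // k kn.
  exact/negP/before.
apply: bigcup_measurable => n _; apply: measurableI.
  exact: measurable_discrete_in.
apply: bigcap_measurableType => k _; apply: measurableC.
exact: measurable_discrete_in.
Qed.

(* Almost surely every transition follows an edge, so the events [X_n \in K] are
   increasing up to null sets, with union the event of entering [C] in [K]. *)
Lemma absorbed_mass_cvg (p : S -> S -> R) X K C : markov_chain P p X ->
  K \subset C ->
  (forall i j, i \in K -> edge p i j -> j \in K) ->
  (forall i j, i \in C :\: K -> edge p i j -> j \in C :\: K) ->
  P [set w | X 0%N w \in ~: C] = 1%E ->
  \sum_(i in K) law P (X n) i @[n --> \oo] -->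
  cond_prob P (stopped_in X (hitting_time X C : T -> \bar R) K) [set w | X 0%N w \in ~: C].
Proof.
move=> mc KC clK clCK PD; have [p_stoch mX _] := mc.
set D := [set w | _ \in ~: C].
set E := stopped_in X (hitting_time X C : T -> \bar R) K.
have mD : measurable D by exact: measurable_discrete_in.
have mE : measurable E by exact: measurable_stopped_in_hitting.
pose F n := [set w | edge p (X n w) (X n.+1 w)].
have FP n : measurable (F n) /\ P (~` F n) = 0%E by exact: markov_chain_follows_edges.
(* On the almost sure event [G] the chain starts outside [C] and always follows edges, so closed
   sets of states trap each individual path. *)
pose G := D `&` \bigcap_n F n.
have mG : measurable G.
  by apply: measurableI => //; apply: bigcapT_measurable => n; case: (FP n).
have PDC : P (~` D) = 0%E by rewrite probability_setC // PD subee.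
have PG : P (~` G) = 0%E.
  apply/negligibleP; first exact: measurableC.
  rewrite /G setCI setC_bigcap; apply: negligibleU.
    apply/negligibleP; first exact: measurableC.
    exact: PDC.
  apply: negligible_bigcup => n; have [mF PF] := FP n.
  by apply/negligibleP => //; apply: measurableC.
have stay (L : {set S}) m n w : (forall i j, i \in L -> edge p i j -> j \in L) ->
    G w -> (m <= n)%N -> X m w \in L -> X n w \in L.
  move=> clL [_ Fw] mn mL; rewrite -(subnKC mn); elim: (n - m)%N => [|k IH].
    by rewrite addn0.
  by rewrite addnS; apply: clL IH (Fw _ _).
pose H n := [set w | X n w \in K] `&` G.
have mH n : measurable (H n) by apply: measurableI => //; apply: measurable_discrete_in.
have HE : \bigcup_n H n = (E `&` D) `&` G.
  apply/seteqP; split=> [w [n _ [nK Gw]]|w [[Ew _] Gw]]; last first.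
    by move: Ew => /(stopped_in_hittingP _ _ KC)[n [_ nK _]]; exists n.
  have [Dw _] := Gw; split=> //; split=> //; apply/(stopped_in_hittingP _ _ KC).
  have nC : X n w \in C by apply: (fintype.subsetP KC).
  have ex : exists n, X n w \in C by exists n.
  have [m mC mmin] := ex_minnP ex.
  have mn : (m <= n)%N by exact: mmin.
  exists m; split.
  (* The hitting time counts only positive times; the start in [D] excludes a first visit at time
     0. *)
  - rewrite lt0n; apply/eqP => m0; move: Dw mC.
    by rewrite m0 /D /= inE => /negPf ->.
  (* Entering [C] outside [K] would trap the path in [C :\: K], although it is in [K] at time
     [n]. *)
  - apply/negPn/negP => mK.
    have : X n w \in C :\: K by apply: (stay _ m) => //; rewrite inE mK.
    by rewrite inE nK.
  - by move=> k /andP[_ km]; apply/negP => /mmin; rewrite leqNgt km.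
(* As [D] has probability 1, conditioning on it only intersects with [D]; the further intersection
   with [G] is free. *)
rewrite /cond_prob PD divr1 -(probability_inter_full _ mG PG); last exact: measurableI.
rewrite -HE; have mUH : measurable (\bigcup_n H n) by exact: bigcup_measurable.
have -> : (fun n => \sum_(i in K) law P (X n) i) = fine \o (P \o H).
  apply/funext => n; rewrite -probability_in_sum_law // /= /H.
  by rewrite probability_inter_full //; apply: measurable_discrete_in.
apply: fine_cvg; rewrite fineK ?fin_num_measure //.
apply: nondecreasing_cvg_mu => // m n mn; apply/subsetPset => w [mK Gw].
by split=> //; apply: (stay K m).
Qed.

End FiniteStateProcess.

(** * Convergence of the laws *)

Theorem fact17 (R : realType) (d : measure_display) (T : measurableType d)
    (P : probability T R) (S : finType) (p : S -> S -> R) (X : nat -> T -> S)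
    (l : nat) (C_ : 'I_l -> {set S}) (mu : 'I_l -> S -> R) :
  markov_chain P p X ->
  injective C_ ->
  (forall A : {set S}, maximal_class (edge p) A <-> exists nu, A = C_ nu) ->
  (forall nu, extreme_invariant p (mu nu) /\ supp (mu nu) = C_ nu) ->
  let C := (\bigcup_(nu < l) C_ nu)%SET in
  let D := (~: C)%SET in
  (forall nu, aperiodic (edge p) (C_ nu)) ->
  P [set w | X 0%N w \in D] = 1%E ->
  let tauC : T -> \bar R := hitting_time X C in
  let p_ := fun nu =>
    cond_prob P (stopped_in X tauC (C_ nu)) [set w | X 0%N w \in D] in
  {ptws, (fun n => law P (X n)) @ \oo -->
    (fun i => \sum_(nu < l) p_ nu * mu nu i)}.
Proof.
move=> mc C_inj maxE muE C D aper PD tauC p_.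
have [p_stoch mX _] := mc.
have succ := stochastic_succ p_stoch.
have maxC nu : maximal_class (edge p) (C_ nu) by apply/maxE; exists nu.
have clC_ nu i j : i \in C_ nu -> edge p i j -> j \in C_ nu.
  exact: maximal_class_closed.
have disj nu nu' i : i \in C_ nu -> i \in C_ nu' -> nu = nu'.
  move=> iA iB; apply: C_inj.
  exact: communicating_class_eq (proj1 (maxC nu)) (proj1 (maxC nu')) iA iB.
have inC nu i : i \in C_ nu -> i \in C by move=> iA; apply/bigcupP; exists nu.
have clC i j : i \in C -> edge p i j -> j \in C.
  by move=> /bigcupP[nu _ iA] /(clC_ _ _ _ iA)/inC.
have clCD nu i j : i \in C :\: C_ nu -> edge p i j -> j \in C :\: C_ nu.
  rewrite !inE => /andP[iA /bigcupP[nu' _ iB]] ij.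
  have jB := clC_ _ _ _ iB ij; rewrite (inC _ _ jB) andbT; apply/negP => jA.
  by rewrite (disj _ _ _ jA jB) iB in iA.
have CC nu : C_ nu \subset C by apply/fintype.subsetP => i; apply: inC.
have lawS n j : law P (X n.+1) j = \sum_i law P (X n) i * p i j.
  exact: law_markov_step.
have law_ge0 n i : 0 <= law P (X n) i by rewrite fine_ge0.
have muS nu j : mu nu j = \sum_i mu nu i * p i j by case: (muE nu) => -[[_ ->]].
have mu0 nu i : i \notin C_ nu -> mu nu i = 0.
  by case: (muE nu) => _ <-; rewrite inE negbK => /eqP.
have mu1 nu : \sum_(i in C_ nu) mu nu i = 1.
  case: (muE nu) => -[[[_ <-] _] _] _; rewrite [RHS](bigID (mem (C_ nu))) /=.
  by rewrite [X in _ + X]big1 ?addr0 //; apply: mu0.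
pose pimu i := \sum_(nu < l) p_ nu * mu nu i.
pose v n i := law P (X n) i - pimu i.
(* The candidate limit [pimu] is a linear combination of invariant vectors, so subtracting it
   preserves the recursion of the laws. *)
have vS n j : v n.+1 j = \sum_i v n i * p i j.
  under eq_bigr do rewrite mulrBl; rewrite sumrB -lawS; congr (_ - _).
  under [RHS]eq_bigr do rewrite mulr_suml.
  rewrite exchange_big; apply: eq_bigr => nu _; rewrite muS mulr_sumr.
  by apply: eq_bigr => i _; rewrite mulrA.
have pimuD i : i \notin C -> pimu i = 0.
  move=> iC; apply: big1 => nu _; rewrite mu0 ?mulr0 //.
  by apply: contra iC; apply: inC.
have pimuC nu i : i \in C_ nu -> pimu i = p_ nu * mu nu i.
  move=> iA; rewrite /pimu (bigD1 nu) //= big1 ?addr0 // => nu' nn.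
  rewrite mu0 ?mulr0 //; apply/negP => iB; move: nn.
  by rewrite (disj _ _ _ iA iB) eqxx.
have [N NP] : exists N, forall i, exists2 j, j \in C & walk (edge p) i j N.
  apply: uniform_walk_to => // i.
  have [A [j [/maxE[nu ->] jA ij]]] := connect_maximal_class succ i.
  by exists j => //; apply: inC jA.
have lawD0 : \sum_(i | i \notin C) law P (X n) i @[n --> \oo] --> 0.
  exact: (transient_mass_cvg0 p_stoch clC NP lawS law_ge0).
have vD0 : \sum_(i | i \notin C) `|v n i| @[n --> \oo] --> 0.
  under eq_fun do under eq_bigr => i iC
    do rewrite /v (pimuD _ iC) subr0 ger0_norm //.
  exact: lawD0.
have vC0 nu : \sum_(i in C_ nu) `|v n i| @[n --> \oo] --> 0.
  have [M MP] := aperiodic_uniform_walk (proj1 (maxC nu)) (aper nu).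
  (* Here [B] is [C :\: C_ nu], the union of the other maximal classes, and what is left outside
     [C_ nu] and [B] is [D]. *)
  apply: (zero_mass_cvg0 p_stoch _ (@clC_ nu) (@clCD nu) _ MP vS).
  - exact: communicating_class_neq0 (proj1 (maxC nu)).
  - by move=> i iA; rewrite inE iA.
  (* Since [mu nu] has mass 1 on [C_ nu], the mass of [v n] there is the mass of the law minus its
     limit [p_ nu]. *)
  - have -> : (fun n => \sum_(i in C_ nu) v n i) =
        (fun n => \sum_(i in C_ nu) law P (X n) i - p_ nu).
      apply/funext => n; rewrite sumrB; congr (_ - _).
      rewrite -[RHS]mulr1 -(mu1 nu) mulr_sumr; apply: eq_bigr => i.
      exact: pimuC.
    rewrite -[X in _ --> X](subrr (p_ nu)); apply: cvgB; last exact: cvg_cst.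
    exact: (absorbed_mass_cvg mc (CC nu) (@clC_ nu) (@clCD nu) PD).
  - have -> : (fun n => \sum_(i | (i \notin C_ nu) && (i \notin C :\: C_ nu))
          `|v n i|) = (fun n => \sum_(i | i \notin C) `|v n i|); last exact: vD0.
      apply/funext => n; apply: eq_bigl => i; rewrite inE.
      by case: (boolP (i \in C_ nu)) => //= /inC ->.
have v0 (Q : {pred S}) i : Q i ->
    \sum_(i | Q i) `|v n i| @[n --> \oo] --> 0 -> v n i @[n --> \oo] --> 0.
  move=> Qi /cvgrPdist_le vQ; apply/cvgrPdist_le => e /vQ; apply: filterS => n.
  rewrite !sub0r !normrN; apply: le_trans; apply: le_trans (ler_norm _).
  by rewrite (bigD1 i) //= lerDl sumr_ge0.
have lawC i : law P (X n) i @[n --> \oo] --> pimu i.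
  have -> : (fun n => law P (X n) i) = (fun n => v n i + pimu i).
    by apply/funext => n; rewrite subrK.
  rewrite -[X in _ --> X]add0r; apply: cvgD; last exact: cvg_cst.
  have [/bigcupP[nu _ iA]|iC] := boolP (i \in C).
    exact: v0 iA (vC0 nu).
  exact: v0 iC vD0.
(* The pointwise topology is the supremum of the topologies induced by the evaluations at [i], so
   convergence of each coordinate suffices. *)
apply/cvg_sup => i.
move=> A; rewrite nbhsE => -[_ [[U oU <-] Uf] sub].
have /lawC : nbhs (pimu i) U by apply: open_nbhs_nbhs.
by move=> [n0 _ lawU]; exists n0 => // n /lawU; apply: sub.
Qed.
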